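(* The ideal $$I=(x^4,\ y^4,\ z^4,\ (x+y)^4,\ (x-y)^4,\ (x+z)^4,\ (x-z)^4,\ (y+z)^4,\ (y-z)^4)\subset\mathbb{C}[x,y,z]$$ fails the SLP at the range $2$ in degree $2$.
   Context: For an artinian homogeneous ideal $I$ in $R=\mathbb{C}[x,y,z]$, put $A=R/I=\bigoplus_jA_j$. For $k\ge1$, $I$ fails the SLP (Strong Lefschetz Property) at the range $k$ in degree $j$ if for every linear form $L$ the multiplication map $\times L^k:A_j\to A_{j+k}$ does not have maximal rank (i.e. is neither injective nor surjective). *)

(* Defs.v *)
From HB Require Import structures.
From mathcomp Require Import all_boot all_order all_algebra ring_quotient.
From mathcomp Require Import boolp classical_sets functions reals.
From mathcomp Require Import complex mpoly.

Set Implicit Arguments.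
Unset Strict Implicit.
Unset Printing Implicit Defensive.

Import GRing.Theory.
Local Open Scope ring_scope.
Local Open Scope quotient_scope.

Section GeneratedIdeal.
Variable R : comNzRingType.

Definition ideal_gen (gs : seq R) : pred R :=
  fun p => `[< exists c : 'I_(size gs) -> R, p = \sum_i c i * gs`_i >].

Lemma ideal_genP (gs : seq R) (p : R) :
  reflect (exists c : 'I_(size gs) -> R, p = \sum_i c i * gs`_i)
          (p \in ideal_gen gs).
Proof. exact: asboolP. Qed.

Lemma ideal_gen_closed (gs : seq R) :
  1 \notin ideal_gen gs -> idealr_closed (ideal_gen gs).
Proof.
move=> gs1; split=> // [|a u v /ideal_genP[c ->] /ideal_genP[d ->]].
  by apply/ideal_genP; exists (fun=> 0); rewrite big1 // => i _; rewrite mul0r.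
apply/ideal_genP; exists (fun i => a * c i + d i).
by rewrite mulr_sumr -big_split; apply: eq_bigr => i _; rewrite mulrDl mulrA.
Qed.

End GeneratedIdeal.

Lemma ideal_gen_proper (K : fieldType) (n : nat) (gs : seq {mpoly K[n]}) :
  all (fun g => g.@[fun=> 0] == 0) gs -> 1 \notin ideal_gen gs.
Proof.
move=> /allP gs0; apply/negP => /ideal_genP[c].
move/(congr1 (meval (fun=> 0))); rewrite meval1 raddf_sum big1.
  by move/eqP; rewrite oner_eq0.
move=> i _ /=; by have /eqP gi0 := gs0 _ (mem_nth 0 (ltn_ord i)); rewrite mevalM gi0 mulr0.
Qed.

Section Lefschetz.
Variables (K : fieldType) (n : nat).
Implicit Type I : idealr {mpoly K[n]}.

(* The homogeneous component A_j of A = {ideal_quot I}, for I homogeneous. *)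
Definition graded_piece I (j : nat) : set {ideal_quot I} :=
  [set a | exists2 p : {mpoly K[n]}, p \is j.-homog & a = \pi_({ideal_quot I}) p]%classic.
Arguments graded_piece : clear implicits.

Definition mul_pow I (L : {mpoly K[n]}) (k : nat) :
    {ideal_quot I} -> {ideal_quot I} :=
  fun a => \pi_({ideal_quot I}) (L ^+ k) * a.
Arguments mul_pow : clear implicits.

(* The zero form is homogeneous of degree 1, so L = 0 is included. *)
Definition fails_SLP I (k j : nat) : Prop :=
  forall L : {mpoly K[n]}, L \is 1.-homog ->
    ~ set_inj (graded_piece I j) (mul_pow I L k) /\
    ~ set_surj (graded_piece I j) (graded_piece I (j + k)%N) (mul_pow I L k).

End Lefschetz.

Section Ideal.
Variable K : fieldType.

Let x : {mpoly K[3]} := 'X_0.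
Let y : {mpoly K[3]} := 'X_1.
Let z : {mpoly K[3]} := 'X_2.

Definition quartic_gens : seq {mpoly K[3]} :=
  [:: x ^+ 4; y ^+ 4; z ^+ 4; (x + y) ^+ 4; (x - y) ^+ 4;
      (x + z) ^+ 4; (x - z) ^+ 4; (y + z) ^+ 4; (y - z) ^+ 4].

Definition quartic_ideal : pred {mpoly K[3]} := ideal_gen quartic_gens.

Lemma quartic_ideal_closed : idealr_closed quartic_ideal.
Proof.
apply/ideal_gen_closed/ideal_gen_proper.
by rewrite /= !rmorphXn /= !(mevalD, mevalN, mevalXU, oppr0, addr0, expr0n) eqxx.
Qed.

HB.instance Definition _ := isIdealr.Build {mpoly K[3]} quartic_ideal quartic_ideal_closed.

Lemma quartic_ideal_homogeneous (d : nat) (p : {mpoly K[3]}) :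
  p \in quartic_ideal -> pihomog mdeg d p \in quartic_ideal.
Proof.
case/ideal_genP=> c ->; rewrite raddf_sum; apply: rpred_sum => i _.
have gi : quartic_gens`_i \in quartic_ideal.
  apply/ideal_genP; exists (fun j => (j == i)%:R).
  rewrite (bigD1 i) //= eqxx mul1r big1 ?addr0 // => j /negPf ->.
  by rewrite mul0r.
have hgi : quartic_gens`_i \is 4.-homog.
  have hom m : 'X_m \is [in K[3], 1.-homog] by rewrite dhomogX /= mdeg1.
  have hom4 q : q \is [in K[3], 1.-homog] -> q ^+ 4 \is 4.-homog.
    exact: (@dhomogMn _ _ mdeg 1 q 4).
  by case: i {gi} => -[|[|[|[|[|[|[|[|[|//]]]]]]]]] ? /=;
    apply: hom4; try exact: hom; (apply: rpredB || apply: rpredD); exact: hom.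
rewrite [c i](pihomog_partitionE (leqnn (msize (c i)))) mulr_suml raddf_sum.
apply: rpred_sum => e _; have hom := dhomogM (pihomogP mdeg e (c i)) hgi.
have [<-|ne] := eqVneq (e + 4)%N d; first by rewrite /= pihomog_dE //; apply: idealMr.
by rewrite /= (pihomog_ne0 _ hom) ?rpred0 // eq_sym.
Qed.

(* A_d = 0 for d >= 10, so the quotient is finite-dimensional. *)
Lemma quartic_ideal_artinian (d : nat) (p : {mpoly K[3]}) :
  (10 <= d)%N -> p \is d.-homog -> p \in quartic_ideal.
Proof.
move=> le10d /dhomogP hp; rewrite [p]mpolyE big_seq; apply: rpred_sum => m mp.
have powJ i : 'X_i ^+ 4 \in quartic_ideal.
  have i0 : (i < size quartic_gens)%N by apply: ltn_trans (ltn_ord i) _.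
  suff -> : 'X_i ^+ 4 = quartic_gens`_(Ordinal i0).
    apply/ideal_genP; exists (fun j => (j == Ordinal i0)%:R).
    rewrite (bigD1 (Ordinal i0)) //= eqxx mul1r big1 ?addr0 // => j /negPf ->.
    by rewrite mul0r.
  by case: i i0 => -[|[|[|//]]] i3 i0 /=; congr ('X__ ^+ 4); apply: val_inj.
have dE : mdeg m = d := hp m mp.
have [i lt4m] : exists i, (4 <= m i)%N.
  apply/existsP; apply: contraTT le10d; rewrite negb_exists -dE -ltnNge.
  move/forallP=> m4; rewrite mdegE !big_ord_recl big_ord0.
  have m3 i : (m i <= 3)%N by rewrite leqNgt m4.
  rewrite addn0 ltnS; apply: (@leq_add _ _ 3 6) => //; exact: (@leq_add _ _ 3 3).
have mE : m = (m - U_(i) *+ 4 + U_(i) *+ 4)%MM.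
  rewrite submK //; apply/mnm_lepP => j; rewrite mulmnE mnm1E.
  by case: eqP => [<-|_]; rewrite ?mul1n.
by rewrite {2}mE mpolyXD -mpolyXn -mul_mpolyC; do 2!apply: idealMr; apply: powJ.
Qed.

End Ideal.

Arguments quartic_gens : clear implicits.
Arguments quartic_ideal : clear implicits.

(* Main.v *)
(* In degree 4 the ideal is spanned by the x_i^4, the x_i^2 x_j^2 and the
   x_i^3 x_j + x_i x_j^3 (sums and differences of (x_i + x_j)^4 and
   (x_i - x_j)^4), so A_2 and A_4 both have dimension 6, with monomial bases.
   For L = ax + by + cz, the 6 x 6 matrix of L^2 : A_2 -> A_4 in these bases
   has determinant identically zero in a, b, c.  A vector of its left kernel is
   a nonzero quadric killed by L^2; a vector of its right kernel is a nonzero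
   linear form on A_4 vanishing on L^2 A_2. *)
Require Import Defs.
From HB Require Import structures.
From mathcomp Require Import all_boot all_order all_algebra ring_quotient.
From mathcomp Require Import reals complex mpoly.
From mathcomp Require Import classical_sets functions.
From mathcomp Require Import ring.

Set Implicit Arguments.
Unset Strict Implicit.
Unset Printing Implicit Defensive.

Import GRing.Theory Num.Theory.
Local Open Scope ring_scope.
Local Open Scope quotient_scope.

(** * Laplace expansion of sparse determinants *)

Section Laplace.
Variable K : comPzRingType.

(* The function [bump], in a form that evaluates without unfolding [leq] and [addn]. *)
Fixpoint skip (j l : nat) : nat :=
  match j, l with
  | 0, _ => l.+1
  | j.+1, 0 => 0%N
  | j.+1, l.+1 => (skip j l).+1
  end.

Lemma skipE j l : skip j l = bump j l.
Proof. by elim: j l => [|j IH] [|l] //=; rewrite IH /bump ltnS addnS. Qed.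

(* [None] encodes a zero entry: a sparse determinant then evaluates to a sum over
   the nonzero entries only, small enough for [ring]. *)
Fixpoint laplace n (f : nat -> nat -> option K) : K :=
  if n is m.+1 then
    foldr (fun j s => if f 0%N j is Some e
                      then (-1) ^+ j * e * laplace m (fun k l => f k.+1 (skip j l)) + s
                      else s) 0 (iota 0 n)
  else 1.

(** Repeated expansion along the first row turns a determinant into an expression in its nonzero
    entries, which [ring] can then decide. *)
Lemma det_laplace n (f : nat -> nat -> option K) :
  \det (\matrix_(i < n, j < n) odflt 0 (f (val i) (val j))) = laplace n f.
Proof.
elim: n f => [|n IH] f; first by rewrite det_mx00.
rewrite (expand_det_row _ ord0).
transitivity (\sum_(j < n.+1) odflt 0 (f 0%N j) *
                ((-1) ^+ j * laplace n (fun k l => f k.+1 (skip j l)))).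
  apply: eq_bigr => j _; rewrite mxE /cofactor add0n -IH; congr (_ * (_ * \det _)).
  by apply/matrixP => k l; rewrite !mxE skipE.
(* The sum over ordinals becomes a fold over [iota 0 n.+1], the list folded by [laplace]. *)
rewrite -(big_mkord xpredT (fun j => odflt 0 (f 0%N j) *
            ((-1) ^+ j * laplace n (fun k l => f k.+1 (skip j l))))).
rewrite unlock /index_iota subn0; cbn [laplace].
elim: (iota 0 n.+1) => //= j s ->.
by case: (f 0%N j) => [e|] /=; rewrite ?mul0r ?add0r // mulrCA mulrA.
Qed.

End Laplace.

(** * Injectivity and surjectivity on polynomial representatives *)

Section MaximalRank.
Variables (K : fieldType) (n : nat) (I : idealr {mpoly K[n]}).
Implicit Types p q L : {mpoly K[n]}.

(** The classes of [p] and 0 are distinct but both are sent to 0. *)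
Lemma not_inj_mul_pow j k L p :
    p \is j.-homog -> p \notin (I : pred _) -> L ^+ k * p \in (I : pred _) ->
  ~ set_inj (graded_piece (I := I) j) (mul_pow (I := I) L k).
Proof.
move=> hp pI LpI inj; apply: (negP pI).
rewrite -[p]subr0 Quotient.idealrBE; apply/eqP.
apply: inj; first by apply/mem_set; exists p.
  by apply/mem_set; exists 0 => //; rewrite dhomog0.
apply/eqP; rewrite /mul_pow -!rmorphM -Quotient.idealrBE -mulrBr subr0.
exact: LpI.
Qed.

(** Lifting to representatives allows surjectivity to be tested by a linear form on polynomials that
    vanishes on [I]. *)
Lemma surj_mul_pow j k L :
    set_surj (graded_piece (I := I) j) (graded_piece (I := I) (j + k)) (mul_pow (I := I) L k) ->
  forall q, q \is (j + k)%N.-homog ->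
  exists2 p, p \is j.-homog & q - L ^+ k * p \in (I : pred _).
Proof.
move=> surj q hq; have [|_ [p hp ->] e] := surj (\pi q); first by exists q.
by exists p => //; rewrite Quotient.idealrBE rmorphM -e.
Qed.

End MaximalRank.

(** * Coefficients of homogeneous polynomials *)

Section Homogeneous.
Variables (K : comNzRingType) (n : nat).
Implicit Types p c g L : {mpoly K[n]}.

Lemma dhomog1_sum L : L \is 1.-homog -> L = \sum_i L@_U_(i) *: 'X_i.
Proof.
move=> hL; apply/mpolyP => m; rewrite raddf_sum /=.
have [/mdeg1P[i /eqP ->]|m1] := boolP (mdeg m == 1%N).
  rewrite (bigD1 i) //= mcoeffZ mcoeffXU eqxx mulr1 big1 ?addr0 // => j /negPf ji.
  by rewrite mcoeffZ mcoeffXU ji mulr0.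
rewrite (dhomog_nemf_coeff hL m1) big1 // => i _.
rewrite mcoeffZ mcoeffX; case: eqP => [e|_]; last by rewrite mulr0.
by rewrite -e mdeg1 in m1.
Qed.

(** Nonconstant terms of [c] push [g] into degrees above [d], so only the constant term reaches
    [m]. *)
Lemma mcoeffM_dhomog d c g m :
  g \is d.-homog -> (mdeg m <= d)%N -> (c * g)@_m = c@_0%MM * g@_m.
Proof.
move=> hg md; elim/mpolyind: c => [|a k q _ _ IH]; first by rewrite mul0r !mcoeff0 mul0r.
rewrite mulrDl !mcoeffD mulrDl IH -scalerAl !mcoeffZ mcoeffX; congr (_ + _).
have [->|k0] := eqVneq k 0%MM; first by rewrite mpolyX0 mul1r mulr1.
rewrite mulr0 mul0r; have hk : 'X_[k] * g \is (mdeg k + d)%N.-homog.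
  by apply: dhomogM => //; rewrite dhomogX.
rewrite (dhomog_nemf_coeff hk) ?mulr0 // neq_ltn; apply/orP; left.
by rewrite -mdeg_eq0 -lt0n in k0; rewrite -add1n leq_add.
Qed.

End Homogeneous.

(** * Monomials in three variables *)

Section QuarticIdeal.
Variable K : numFieldType.

Local Notation x := ('X_0 : {mpoly K[3]}).
Local Notation y := ('X_1 : {mpoly K[3]}).
Local Notation z := ('X_2 : {mpoly K[3]}).
Local Notation I := (quartic_ideal K).

Definition mnm3 (i j k : nat) : 'X_{1..3} :=
  (U_(0%R) *+ i + U_(1%R) *+ j + U_(2%R) *+ k)%MM.

Lemma mon3E i j k : x ^+ i * y ^+ j * z ^+ k = 'X_[mnm3 i j k].
Proof. by rewrite /mnm3 !mpolyXD !mpolyXn. Qed.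

Lemma mnm3_eq i j k i' j' k' :
  (mnm3 i j k == mnm3 i' j' k') = [&& i == i', j == j' & k == k'].
Proof.
apply/eqP/and3P => [/mnmP e|[/eqP-> /eqP-> /eqP->] //].
have := (e 0, e 1, e 2); rewrite /mnm3 !mnmDE !mulmnE !mnm1E /= !mul0n !mul1n ?addn0 ?add0n.
by case=> [[-> ->] ->]; rewrite !eqxx.
Qed.

Lemma mdeg_mnm3 i j k : mdeg (mnm3 i j k) = (i + j + k)%N.
Proof. by rewrite /mnm3 !mdegD !mdegMn !mdeg1 !mul1n. Qed.

Lemma mnm3E (m : 'X_{1..3}) : m = mnm3 (m 0) (m 1) (m 2).
Proof.
apply/mnmP => l; rewrite /mnm3 !mnmDE !mulmnE !mnm1E.
by case: l => -[|[|[|//]]] l3; rewrite /= !mul0n !mul1n ?addn0 ?add0n;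
  congr (m _); apply: val_inj.
Qed.

(** * Elements of the ideal in degree 4 *)

Lemma quartic_gens_in (l : 'I_9) : (quartic_gens K)`_l \in I.
Proof.
apply/ideal_genP; exists (fun j => (j == l)%:R).
rewrite (bigD1 l) //= eqxx mul1r big1 ?addr0 // => j /negPf ->.
by rewrite mul0r.
Qed.

Lemma quartic_gens_homog (l : 'I_9) : (quartic_gens K)`_l \is 4.-homog.
Proof.
have hom m : 'X_m \is [in K[3], 1.-homog] by rewrite dhomogX /= mdeg1.
have hom4 q : q \is [in K[3], 1.-homog] -> q ^+ 4 \is 4.-homog.
  exact: (@dhomogMn _ _ mdeg 1 q 4).
by case: l => -[|[|[|[|[|[|[|[|[|//]]]]]]]]] ? /=;
  apply: hom4; try exact: hom; (apply: rpredB || apply: rpredD); exact: hom.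
Qed.

Lemma quartic_ideal_pair (u v : {mpoly K[3]}) :
    u ^+ 4 \in I -> v ^+ 4 \in I -> (u + v) ^+ 4 \in I -> (u - v) ^+ 4 \in I ->
  u ^+ 2 * v ^+ 2 \in I /\ u ^+ 3 * v + u * v ^+ 3 \in I.
Proof.
move=> u4 v4 uDv4 uBv4.
(* Characteristic zero makes the integer [m.+1] invertible. *)
have scaleI (m : nat) (p : {mpoly K[3]}) : p *+ m.+1 \in I -> p \in I.
  move=> pI; have -> : p = (m.+1%:R^-1 : K)%:MP * (p *+ m.+1).
    by rewrite mulrnAr -mulrnAl -rmorphMn /= -[_ *+ _]mulr_natl mulfV ?pnatr_eq0 // mul1r.
  exact: idealMr.
(* [scaleI] divides by the successor of its argument: the factors are 12 and 8. *)
split; [apply: (scaleI 11) | apply: (scaleI 7)].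
- have -> : (u ^+ 2 * v ^+ 2) *+ 12 = (u + v) ^+ 4 + (u - v) ^+ 4 - 2 * u ^+ 4 - 2 * v ^+ 4.
    by ring.
  by apply: rpredB (idealMr _ v4); apply: rpredB (idealMr _ u4); apply: rpredD.
- have -> : (u ^+ 3 * v + u * v ^+ 3) *+ 8 = (u + v) ^+ 4 - (u - v) ^+ 4 by ring.
  exact: rpredB.
Qed.

(** * Monomial bases in degrees 2 and 4 *)

Definition quadrics : seq 'X_{1..3} :=
  [:: mnm3 2 0 0; mnm3 0 2 0; mnm3 0 0 2; mnm3 1 1 0; mnm3 1 0 1; mnm3 0 1 1].

(** One monomial is kept from each pair x_i^3 x_j, x_i x_j^3, these being opposite in A_4; the x_i^4
    and x_i^2 x_j^2 vanish there. *)
Definition quartics : seq 'X_{1..3} :=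
  [:: mnm3 3 1 0; mnm3 3 0 1; mnm3 0 3 1; mnm3 2 1 1; mnm3 1 2 1; mnm3 1 1 2].

Local Notation quadric i := (nth 0%MM quadrics i).
Local Notation quartic i := (nth 0%MM quartics i).

Lemma quadric_eq (i j : 'I_6) : (quadric i == quadric j) = (i == j).
Proof. by rewrite nth_uniq //= !inE !mnm3_eq. Qed.

Lemma quartic_eq (i j : 'I_6) : (quartic i == quartic j) = (i == j).
Proof. by rewrite nth_uniq //= !inE !mnm3_eq. Qed.

Lemma quadric_surj (m : 'X_{1..3}) : mdeg m = 2%N -> exists i : 'I_6, m = quadric i.
Proof.
rewrite [m]mnm3E; move: (m 0) (m 1) (m 2) => i j k.
rewrite mdeg_mnm3 => e.
suff: mnm3 i j k \in quadrics.
  by move=> h; rewrite -index_mem in h; exists (Ordinal h); rewrite nth_index // -index_mem.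
rewrite !inE !mnm3_eq.
by case: i j k e => [|[|[|i]]] [|[|[|j]]] [|[|[|k]]].
Qed.

Lemma mdeg_quadric (i : 'I_6) : mdeg (quadric i) = 2%N.
Proof. by case: i => -[|[|[|[|[|[|//]]]]]] i6; rewrite mdeg_mnm3. Qed.

Lemma mdeg_quartic (i : 'I_6) : mdeg (quartic i) = 4%N.
Proof. by case: i => -[|[|[|[|[|[|//]]]]]] i6; rewrite mdeg_mnm3. Qed.

(** * The matrix of multiplication by L^2 *)

(* Row i expands L^2 times the i-th quadric in the quartics, using
   x y^3 = - x^3 y, x z^3 = - x^3 z and y z^3 = - y^3 z in A_4. *)
Definition square_mul_coef (a b c : K) (i j : nat) : option K :=
  nth None (nth [::]
    [:: [:: Some (2 * a * b); Some (2 * a * c); None; Some (2 * b * c); None; None];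
        [:: Some (- (2 * a * b)); None; Some (2 * b * c); None; Some (2 * a * c); None];
        [:: None; Some (- (2 * a * c)); Some (- (2 * b * c)); None; None; Some (2 * a * b)];
        [:: Some (a ^+ 2 - b ^+ 2); None; None; Some (2 * a * c); Some (2 * b * c); Some (c ^+ 2)];
        [:: None; Some (a ^+ 2 - c ^+ 2); None; Some (2 * a * b); Some (b ^+ 2); Some (2 * b * c)];
        [:: None; None; Some (b ^+ 2 - c ^+ 2); Some (a ^+ 2); Some (2 * a * b); Some (2 * a * c)]] i) j.

Lemma laplace_square_mul a b c : laplace 6 (square_mul_coef a b c) = 0.
Proof.
(* Only the expansion is evaluated; the field operations stay folded so that [ring] sees a
   polynomial in [a], [b], [c]. *)
lazy [laplace skip foldr iota square_mul_coef nth].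
ring.
Qed.

Definition square_mul_mx (a b c : K) : 'M[K]_6 :=
  \matrix_(i, j) odflt 0 (square_mul_coef a b c (val i) (val j)).

Lemma det_square_mul a b c : \det (square_mul_mx a b c) = 0.
Proof. by rewrite det_laplace laplace_square_mul. Qed.

Lemma square_mul_mod (a b c : K) (i : 'I_6) :
  (a *: x + b *: y + c *: z) ^+ 2 * 'X_[quadric i] -
    \sum_(j < 6) square_mul_mx a b c i j *: 'X_[quartic j] \in I.
Proof.
have gI k : (k < 9)%N -> (quartic_gens K)`_k \in I.
  by move=> k9; exact: (quartic_gens_in (Ordinal k9)).
have x4 : x ^+ 4 \in I by apply: (gI 0%N).
have y4 : y ^+ 4 \in I by apply: (gI 1%N).
have z4 : z ^+ 4 \in I by apply: (gI 2%N).
have [xxyy xxxy] := quartic_ideal_pair x4 y4 (gI 3%N isT) (gI 4%N isT).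
have [xxzz xxxz] := quartic_ideal_pair x4 z4 (gI 5%N isT) (gI 6%N isT).
have [yyzz yyyz] := quartic_ideal_pair y4 z4 (gI 7%N isT) (gI 8%N isT).
rewrite !big_ord_recl big_ord0 !mxE -!mul_mpolyC.
have IE p q : q \in I -> p = q -> p \in I by move=> qI ->.
have D p q : p \in I -> q \in I -> p + q \in I by exact: rpredD.
have M p q : q \in I -> p * q \in I by exact: idealMr.
pose A := a%:MP_[3]; pose B := b%:MP_[3]; pose C := c%:MP_[3].
(* In each row, the multiplier of an ideal element is the coefficient, in L^2 times the quadric, of
   its monomial outside [quartics]. *)
case: i => -[|[|[|[|[|[|//]]]]]] i6; rewrite /square_mul_coef /bump /= -!mon3E.
- apply: (IE _ _ (D _ _ (M (A ^+ 2) _ x4) (D _ _ (M (B ^+ 2) _ xxyy) (M (C ^+ 2) _ xxzz)))).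
  rewrite /A /B /C; ring.
- apply: (IE _ _ (D _ _ (M (B ^+ 2) _ y4) (D _ _ (M (A ^+ 2) _ xxyy)
    (D _ _ (M (C ^+ 2) _ yyzz) (M (2 * A * B) _ xxxy))))).
  rewrite /A /B /C; ring.
- apply: (IE _ _ (D _ _ (M (C ^+ 2) _ z4) (D _ _ (M (A ^+ 2) _ xxzz) (D _ _ (M (B ^+ 2) _ yyzz)
    (D _ _ (M (2 * A * C) _ xxxz) (M (2 * B * C) _ yyyz)))))).
  rewrite /A /B /C; ring.
- apply: (IE _ _ (D _ _ (M (B ^+ 2) _ xxxy) (M (2 * A * B) _ xxyy))).
  rewrite /A /B /C; ring.
- apply: (IE _ _ (D _ _ (M (C ^+ 2) _ xxxz) (M (2 * A * C) _ xxzz))).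
  rewrite /A /B /C; ring.
- apply: (IE _ _ (D _ _ (M (C ^+ 2) _ yyyz) (M (2 * B * C) _ yyzz))).
  rewrite /A /B /C; ring.
Qed.

(** * Linear forms on A_4 *)

(* The linear form on A_4 with values w on the basis of quartics, lifted to
   polynomials; the subtracted terms encode x_i x_j^3 = - x_i^3 x_j. *)
Definition apolar (w : 'rV[K]_6) (p : {mpoly K[3]}) : K :=
  \sum_(j < 6) w 0 j * p@_(quartic j) -
  (w 0 0 * p@_(mnm3 1 3 0) + w 0 1 * p@_(mnm3 1 0 3) + w 0 2 * p@_(mnm3 0 1 3)).

Lemma apolar_is_scalar w : scalar (apolar w).
Proof.
move=> a p q; rewrite /apolar !mcoeffD !mcoeffZ.
under eq_bigr do rewrite mcoeffD mcoeffZ mulrDr mulrCA.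
rewrite big_split -mulr_sumr /=; ring.
Qed.

HB.instance Definition _ w :=
  GRing.isLinear.Build K {mpoly K[3]} K *%R (apolar w) (@apolar_is_scalar w).

Lemma apolar_quartic w (k : 'I_6) : apolar w 'X_[quartic k] = w 0 k.
Proof.
rewrite /apolar (bigD1 k) //= mcoeffX eqxx mulr1 big1 => [|j jk]; last first.
  by rewrite mcoeffX quartic_eq eq_sym (negPf jk) mulr0.
by case: k => -[|[|[|[|[|[|//]]]]]] k6; rewrite !mcoeffX !mnm3_eq /= !mulr0 !addr0 subr0.
Qed.

(** [apolar] reads only coefficients of degree 4, so vanishing on the ideal reduces to vanishing on
    its generators. *)
Lemma apolarM_dhomog w (c g : {mpoly K[3]}) :
  g \is 4.-homog -> apolar w (c * g) = c@_0%MM * apolar w g.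
Proof.
move=> hg; rewrite /apolar mulrBr mulr_sumr !mulrDr.
rewrite !(mcoeffM_dhomog _ hg) ?mdeg_mnm3 //.
under eq_bigr => j _ do rewrite (mcoeffM_dhomog _ hg) ?mdeg_quartic // mulrCA.
by rewrite ![w _ _ * (_ * _)]mulrCA.
Qed.

(** Equal coefficients at x_i^3 x_j and x_i x_j^3 cancel; this covers x_i^4, x_i^2 x_j^2 and x_i^3
    x_j + x_i x_j^3. *)
Lemma apolar_eq0 w (p : {mpoly K[3]}) :
    [/\ p@_(mnm3 3 1 0) = p@_(mnm3 1 3 0), p@_(mnm3 3 0 1) = p@_(mnm3 1 0 3)
      & p@_(mnm3 0 3 1) = p@_(mnm3 0 1 3)] ->
    [/\ p@_(mnm3 2 1 1) = 0, p@_(mnm3 1 2 1) = 0 & p@_(mnm3 1 1 2) = 0] ->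
  apolar w p = 0.
Proof.
move=> [e1 e2 e3] [e4 e5 e6]; rewrite /apolar !big_ord_recl big_ord0 /=.
rewrite e1 e2 e3 e4 e5 e6 !mulr0 !addr0 addrA.
by apply/eqP; rewrite subr_eq0; apply/eqP; congr (_ * _ + _ * _ + _ * _);
  congr (w _ _); apply: val_inj.
Qed.

Lemma apolar_pair w (u v : {mpoly K[3]}) :
    [/\ apolar w (u ^+ 4) = 0, apolar w (v ^+ 4) = 0, apolar w (u ^+ 2 * v ^+ 2) = 0
      & apolar w (u ^+ 3 * v + u * v ^+ 3) = 0] ->
  apolar w ((u + v) ^+ 4) = 0 /\ apolar w ((u - v) ^+ 4) = 0.
Proof.
move=> [u4 v4 uuvv uuuv].
have -> : (u + v) ^+ 4 =
    u ^+ 4 + v ^+ 4 + (u ^+ 2 * v ^+ 2) *+ 6 + (u ^+ 3 * v + u * v ^+ 3) *+ 4 by ring.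
have -> : (u - v) ^+ 4 =
    u ^+ 4 + v ^+ 4 + (u ^+ 2 * v ^+ 2) *+ 6 - (u ^+ 3 * v + u * v ^+ 3) *+ 4 by ring.
rewrite raddfB 3!raddfD !raddfMn /= u4 v4 uuvv uuuv.
by rewrite ?oppr0 !mul0rn ?oppr0 !addr0.
Qed.

Lemma apolar_quartic_gens w (l : 'I_9) : apolar w (quartic_gens K)`_l = 0.
Proof.
have mon i j k p : p = x ^+ i * y ^+ j * z ^+ k -> p = 'X_[mnm3 i j k].
  by rewrite mon3E.
have x4 : apolar w (x ^+ 4) = 0.
  rewrite (mon 4%N 0%N 0%N (x ^+ 4)); last by ring.
  by apply: apolar_eq0; rewrite !mcoeffX !mnm3_eq.
have y4 : apolar w (y ^+ 4) = 0.
  rewrite (mon 0%N 4%N 0%N (y ^+ 4)); last by ring.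
  by apply: apolar_eq0; rewrite !mcoeffX !mnm3_eq.
have z4 : apolar w (z ^+ 4) = 0.
  rewrite (mon 0%N 0%N 4%N (z ^+ 4)); last by ring.
  by apply: apolar_eq0; rewrite !mcoeffX !mnm3_eq.
have [xDy xBy] : apolar w ((x + y) ^+ 4) = 0 /\ apolar w ((x - y) ^+ 4) = 0.
  apply: apolar_pair; split=> //.
    rewrite (mon 2%N 2%N 0%N (x ^+ 2 * y ^+ 2)); last by ring.
    by apply: apolar_eq0; rewrite !mcoeffX !mnm3_eq.
  rewrite (mon 3%N 1%N 0%N (x ^+ 3 * y)); last by ring.
  rewrite (mon 1%N 3%N 0%N (x * y ^+ 3)); last by ring.
  by apply: apolar_eq0; rewrite !mcoeffD !mcoeffX !mnm3_eq /= ?addr0 ?add0r.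
have [xDz xBz] : apolar w ((x + z) ^+ 4) = 0 /\ apolar w ((x - z) ^+ 4) = 0.
  apply: apolar_pair; split=> //.
    rewrite (mon 2%N 0%N 2%N (x ^+ 2 * z ^+ 2)); last by ring.
    by apply: apolar_eq0; rewrite !mcoeffX !mnm3_eq.
  rewrite (mon 3%N 0%N 1%N (x ^+ 3 * z)); last by ring.
  rewrite (mon 1%N 0%N 3%N (x * z ^+ 3)); last by ring.
  by apply: apolar_eq0; rewrite !mcoeffD !mcoeffX !mnm3_eq /= ?addr0 ?add0r.
have [yDz yBz] : apolar w ((y + z) ^+ 4) = 0 /\ apolar w ((y - z) ^+ 4) = 0.
  apply: apolar_pair; split=> //.
    rewrite (mon 0%N 2%N 2%N (y ^+ 2 * z ^+ 2)); last by ring.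
    by apply: apolar_eq0; rewrite !mcoeffX !mnm3_eq.
  rewrite (mon 0%N 3%N 1%N (y ^+ 3 * z)); last by ring.
  rewrite (mon 0%N 1%N 3%N (y * z ^+ 3)); last by ring.
  by apply: apolar_eq0; rewrite !mcoeffD !mcoeffX !mnm3_eq /= ?addr0 ?add0r.
by case: l => -[|[|[|[|[|[|[|[|[|//]]]]]]]]] l9 /=.
Qed.

Lemma apolar_quartic_ideal w p : p \in I -> apolar w p = 0.
Proof.
case/ideal_genP=> c ->; rewrite raddf_sum big1 // => l _ /=.
by rewrite (apolarM_dhomog _ _ (quartic_gens_homog l)) apolar_quartic_gens mulr0.
Qed.

(** On L^2 times the i-th quadric, [apolar w] takes as value the i-th entry of
    [w *m (square_mul_mx a b c)^T]. *)
Lemma apolar_square_mul w (a b c : K) (p : {mpoly K[3]}) :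
    w *m (square_mul_mx a b c)^T = 0 -> p \is 2.-homog ->
  apolar w ((a *: x + b *: y + c *: z) ^+ 2 * p) = 0.
Proof.
move=> wM /dhomogP hp; rewrite [p]mpolyE mulr_sumr raddf_sum big_seq big1 // => m /hp /=.
case/quadric_surj=> i ->; rewrite -scalerAr linearZ /=.
have := apolar_quartic_ideal w (square_mul_mod a b c i).
rewrite raddfB /= => /eqP; rewrite subr_eq0 => /eqP ->.
rewrite raddf_sum /=; under eq_bigr do rewrite linearZ /= apolar_quartic.
move/matrixP: wM => /(_ 0 i); rewrite [LHS]mxE [RHS]mxE => wMi.
rewrite [X in _ * X](_ : _ = 0) ?mulr0 // -[RHS]wMi.
by apply: eq_bigr => j _; rewrite [_^T _ _]mxE mulrC.
Qed.

(** * Failure of injectivity and surjectivity *)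

Lemma quartic_ideal_low (p : {mpoly K[3]}) (m : 'X_{1..3}) :
  (mdeg m < 4)%N -> p \in I -> p@_m = 0.
Proof.
move=> m4 /ideal_genP[c ->]; rewrite raddf_sum big1 // => l _ /=.
(* Only the constant term of [c l] could contribute, and it multiplies a coefficient of a quartic in
   degree below 4. *)
rewrite (mcoeffM_dhomog _ (quartic_gens_homog l) (ltnW m4)).
by rewrite (dhomog_nemf_coeff (quartic_gens_homog l)) ?mulr0 // ltn_eqF.
Qed.

Lemma dhomog1_3 (L : {mpoly K[3]}) :
  L \is 1.-homog -> exists a b c : K, L = a *: x + b *: y + c *: z.
Proof.
move=> /dhomog1_sum ->; rewrite !big_ord_recl big_ord0 addr0 addrA.
by eexists _, _, _; congr (_ *: 'X_ _ + _ *: 'X__ + _ *: 'X__); apply: val_inj.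
Qed.

Lemma quartic_ideal_fails_SLP : fails_SLP I 2 2.
Proof.
move=> L /dhomog1_3[a [b [c ->]]]; set L2 := _ + _; split.
  have /det0P[v v0 vM] : \det (square_mul_mx a b c) == 0 by rewrite det_square_mul.
  apply: (@not_inj_mul_pow _ _ _ 2 2 _ (\sum_(i < 6) v 0 i *: 'X_[quadric i])).
  - by apply: rpred_sum => i _; apply: rpredZ; rewrite dhomogX /= mdeg_quadric.
  (* The ideal has no nonzero element of degree 2, so membership would force every [v 0 i] to be
     0. *)
  - apply: contra v0 => pI; apply/eqP/rowP => i; rewrite mxE.
    rewrite -[RHS](@quartic_ideal_low _ (quadric i) _ pI) ?mdeg_quadric //.
    rewrite raddf_sum (bigD1 i) //= mcoeffZ mcoeffX eqxx mulr1 big1 ?addr0 // => j ji.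
    by rewrite mcoeffZ mcoeffX quadric_eq (negPf ji) mulr0.
  (* The subtracted terms add up to zero because [v] kills the matrix, and each bracket lies in the
     ideal. *)
  - have -> : L2 ^+ 2 * (\sum_(i < 6) v 0 i *: 'X_[quadric i]) =
        \sum_(i < 6) (v 0 i)%:MP * (L2 ^+ 2 * 'X_[quadric i] -
           \sum_(j < 6) square_mul_mx a b c i j *: 'X_[quartic j]).
      rewrite mulr_sumr; under [RHS]eq_bigr do rewrite mulrBr mul_mpolyC scalerAr.
      rewrite sumrB [X in _ - X](_ : _ = 0) ?subr0 //.
      under eq_bigr do rewrite mul_mpolyC scaler_sumr.
      rewrite exchange_big big1 // => j _ /=.
      under eq_bigr do rewrite scalerA.
      move/matrixP: vM => /(_ 0 j); rewrite [LHS]mxE [RHS]mxE => vMj.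
      by rewrite -scaler_suml vMj scale0r.
    by apply: rpred_sum => i _; apply: idealMr; apply: square_mul_mod.
have /det0P[w w0 wM] : \det (square_mul_mx a b c)^T == 0 by rewrite det_tr det_square_mul.
move=> /surj_mul_pow surj; case/negP: w0; apply/eqP/rowP => k; rewrite mxE.
(* A preimage of the k-th quartic gives [w 0 k] = [apolar w (L2 ^+ 2 * p)] = 0; over all [k] this
   contradicts [w] being nonzero. *)
have [|p hp] := surj 'X_[quartic k]; first by rewrite dhomogX /= mdeg_quartic.
move/(apolar_quartic_ideal w); rewrite raddfB /= apolar_quartic.
by rewrite (apolar_square_mul wM hp) subr0.
Qed.

End QuarticIdeal.

Theorem proposition7p3 (R : realType) : fails_SLP (quartic_ideal R[i]) 2 2.
Proof. exact: quartic_ideal_fails_SLP. Qed.
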